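(* Let $\mathcal{Q}$ be a collection of finite initially connected initialized automata, and let $\mathcal{G}$ be the collection of finite simple groups that divide the monoid $M(\mathbf{Q})$ of some $(\mathbf{Q},q)\in\mathcal{Q}$. Then a Conway category satisfies the identities $\Gamma(\mathbf{Q},q)$ for all $(\mathbf{Q},q)\in\mathcal{Q}$ if and only if it satisfies the group identities $\Gamma(G)$ for all $G\in\mathcal{G}$.
   Context: Cartesian categories have chosen finite products (terminal object $T$, projections $\pi_i$, tupling $\langle\cdot\rangle$, $!_A:A\to T$, $f\times g$), strictly associative; composition is written $g\circ f$; $\Delta_{A^n}=\langle 1_A,\ldots,1_A\rangle:A\to A^n$. A dagger operation maps $f:A\times C\to A$ to $f^\dagger:C\to A$. A Conway category is a cartesian category with dagger satisfying: $(f\circ(1_A\times g))^\dagger=f^\dagger\circ g$ ($f:A\times B\to A$, $g:C\to B$); $f^{\dagger\dagger}=(f\circ(\Delta_{A^2}\times 1_C))^\dagger$ ($f:A\times A\times C\to A$); $(f\circ\langle g,\pi_2^{A\times C}\rangle)^\dagger=f\circ\langle (g\circ\langle f,\pi_2^{B\times C}\rangle)^\dagger,1_C\rangle$ ($f:B\times C\to A$, $g:A\times C\to B$). A finite automaton $\mathbf{Q}=(Q,Z,\cdot)$ has finite nonempty state set $Q$, finite nonempty input alphabet $Z$ and action $Q\times Z\to Q$, extended to words; $M(\mathbf{Q})$ is the monoid of functions $Q\to Q$, $q\mapsto qu$, induced by words $u\in Z^*$. Write $Q=\{q_1,\ldots,q_n\}$, identified with $\{1,\ldots,n\}$, and $Z=\{a_1,\ldots,a_m\}$.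 For an object $A$ and $i\in[n]$ let $\rho_i^{\mathbf{Q},A}=\langle\pi^{A^n}_{ia_1},\ldots,\pi^{A^n}_{ia_m}\rangle:A^n\to A^m$ ($ia_j$ is the index of $q_i\cdot a_j$). For $f:A^m\times C\to A$ let $f^{\mathbf{Q},A}:A^n\times C\to A^n$ have components $\pi_i^{A^n}\circ f^{\mathbf{Q},A}=f\circ(\rho_i^{\mathbf{Q},A}\times 1_C)$. The identity $\Gamma(\mathbf{Q})$ holds in $\mathcal{C}$ if $(f^{\mathbf{Q},A})^\dagger=\Delta_{A^n}\circ(f\circ(\Delta_{A^m}\times 1_C))^\dagger$ for all objects $A,C$ and all $f:A^m\times C\to A$. An initialized automaton $(\mathbf{Q},q_i)$ has a distinguished state; $\Gamma(\mathbf{Q},q_i)$ holds if $\pi_i^{A^n}\circ(f^{\mathbf{Q},A})^\dagger=(f\circ(\Delta_{A^m}\times 1_C))^\dagger$ for all such $A,C,f$. $(\mathbf{Q},q)$ is initially connected if every state equals $qu$ for some word $u$. For a finite group $G$, $\Gamma(G)$ is $\Gamma$ of the automaton $(G,G,\cdot)$ with action by multiplication. A group in a finite monoid $M$ is a subsemigroup which is a group; a finite group divides $M$ if it is a homomorphic image of a group in $M$. A finite group is simple if it is nontrivial and has no normal subgroups other than itself and the trivial one. *)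

(* Defs.v *)
From mathcomp Require Import all_boot all_fingroup.
From mathcomp Require Import gseries.

Set Implicit Arguments.
Unset Strict Implicit.
Unset Printing Implicit Defensive.

Record cartCat := CartCat {
  Obj :> Type;
  Hom : Obj -> Obj -> Type;
  idm : forall A, Hom A A;
  comp : forall A B C, Hom B C -> Hom A B -> Hom A C;
  comp_assoc : forall A B C D (h : Hom C D) (g : Hom B C) (f : Hom A B),
      comp h (comp g f) = comp (comp h g) f;
  comp_id_l : forall A B (f : Hom A B), comp (idm B) f = f;
  comp_id_r : forall A B (f : Hom A B), comp f (idm A) = f;
  Ter : Obj;
  bang : forall A, Hom A Ter;
  bang_uniq : forall A (f : Hom A Ter), f = bang A;
  prod : Obj -> Obj -> Obj;
  pi1 : forall A B, Hom (prod A B) A;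
  pi2 : forall A B, Hom (prod A B) B;
  pair : forall X A B, Hom X A -> Hom X B -> Hom X (prod A B);
  pi1_pair : forall X A B (f : Hom X A) (g : Hom X B), comp (pi1 A B) (pair f g) = f;
  pi2_pair : forall X A B (f : Hom X A) (g : Hom X B), comp (pi2 A B) (pair f g) = g;
  pair_uniq : forall X A B (h : Hom X (prod A B)),
      h = pair (comp (pi1 A B) h) (comp (pi2 A B) h)
}.

Arguments Hom {K} : rename.
Arguments idm {K} A : rename.
Arguments comp {K A B C} : rename.
Arguments Ter {K} : rename.
Arguments bang {K} A : rename.
Arguments prod {K} : rename.
Arguments pi1 {K} A B : rename.
Arguments pi2 {K} A B : rename.
Arguments pair {K X A B} : rename.

Section CartDefs.
Variable K : cartCat.

Definition pmap A B A' B' (f : @Hom K A A') (g : @Hom K B B') :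
    Hom (prod A B) (prod A' B') :=
  pair (comp f (pi1 A B)) (comp g (pi2 A B)).

(* powS A k = A^(k+1) = A x (A x ... x A), with A^1 = A. *)
Fixpoint powS (A : K) (k : nat) : K :=
  match k with 0 => A | S k' => prod A (powS A k') end.

Definition pw (A : K) (n : nat) : K :=
  match n with 0 => Ter | S k => powS A k end.

Fixpoint tupS (X A : K) (k : nat) : ('I_k.+1 -> Hom X A) -> Hom X (powS A k) :=
  match k return ('I_k.+1 -> Hom X A) -> Hom X (powS A k) with
  | 0 => fun fs => fs ord0
  | S k' => fun fs => pair (fs ord0) (@tupS X A k' (fun i => fs (lift ord0 i)))
  end.

Definition tup (X A : K) (n : nat) : ('I_n -> Hom X A) -> Hom X (pw A n) :=
  match n return ('I_n -> Hom X A) -> Hom X (pw A n) with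
  | 0 => fun _ => bang X
  | S k => @tupS X A k
  end.

Fixpoint projS (A : K) (k : nat) : 'I_k.+1 -> Hom (powS A k) A :=
  match k return 'I_k.+1 -> Hom (powS A k) A with
  | 0 => fun _ => idm A
  | S k' => fun i => match unlift ord0 i with
                     | None => pi1 A (powS A k')
                     | Some j => comp (@projS A k' j) (pi2 A (powS A k'))
                     end
  end.

Definition ord0_absurd (i : 'I_0) : False :=
  (fun e : false = true => match e in _ = b return (if b then False else True) with erefl => I end) (ltn_ord i).

Definition proj (A : K) (n : nat) : 'I_n -> Hom (pw A n) A :=
  match n return 'I_n -> Hom (pw A n) A with
  | 0 => fun i => False_rect _ (ord0_absurd i)
  | S k => @projS A k
  end.

Definition diag (A : K) (n : nat) : Hom A (pw A n) := @tup A A n (fun _ => idm A).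

End CartDefs.

Arguments pmap {K A B A' B'}.
Arguments pw {K}.
Arguments tup {K X A n}.
Arguments proj {K A n}.
Arguments diag {K}.

Definition daggerOp (K : cartCat) :=
  forall (A C : K), Hom (prod A C) A -> Hom C A.

Definition conway (K : cartCat) (dag : daggerOp K) : Prop :=
  (forall (A B C : K) (f : Hom (prod A B) A) (g : Hom C B),
      dag A C (comp f (pmap (idm A) g)) = comp (dag A B f) g) /\
  (* double dagger identity: f : A x A x C -> A; here Delta_{A^2} x 1_C :
     A x C -> A x (A x C) is <pi1, <pi1, pi2>> *)
  (forall (A C : K) (f : Hom (prod A (prod A C)) A),
      dag A C (dag A (prod A C) f)
      = dag A C (comp f (pair (pi1 A C) (pair (pi1 A C) (pi2 A C))))) /\
  (forall (A B C : K) (f : Hom (prod B C) A) (g : Hom (prod A C) B),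
      dag A C (comp f (pair g (pi2 A C)))
      = comp f (pair (dag B C (comp g (pair f (pi2 B C)))) (idm C))).

Record automaton := Automaton {
  st : finType;
  al : finType;
  act : st -> al -> st;
  st_nonempty : 0 < #|st|;
  al_nonempty : 0 < #|al|
}.

Definition actw (Q : automaton) (q : st Q) (u : seq (al Q)) : st Q :=
  foldl (@act Q) q u.

Definition init_automaton := { Q : automaton & st Q }.

Definition initially_connected (Qq : init_automaton) : Prop :=
  forall q' : st (projT1 Qq), exists u : seq (al (projT1 Qq)),
    q' = actw (projT2 Qq) u.

(* The monoid M(Q): maps q |-> qu induced by words u; product of the maps
   of u and v is the map of uv, i.e. first u then v. *)
Definition inM (Q : automaton) (f : {ffun st Q -> st Q}) : Prop :=
  exists u : seq (al Q), forall q, f q = actw q u.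

Definition Mmul (Q : automaton) (f g : {ffun st Q -> st Q}) : {ffun st Q -> st Q} :=
  [ffun q => g (f q)].

(* A finite group G divides M(Q): G is a homomorphic image of a group in
   M(Q), i.e. of a subsemigroup H of M(Q) which is a group (with its own
   identity e). *)
Definition divides_monoid (G : finGroupType) (Q : automaton) : Prop :=
  exists (H : {set {ffun st Q -> st Q}}) (e : {ffun st Q -> st Q}),
    [/\ (forall h, h \in H -> inM h),
        (forall x y, x \in H -> y \in H -> Mmul x y \in H) /\ e \in H,
        (forall x, x \in H -> Mmul e x = x /\ Mmul x e = x),
        (forall x, x \in H -> exists2 y, y \in H & Mmul x y = e /\ Mmul y x = e) &
        exists phi : {ffun st Q -> st Q} -> G,
          (forall x y, x \in H -> y \in H -> phi (Mmul x y) = (phi x * phi y)%g) /\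
          (forall g : G, exists2 x, x \in H & phi x = g)].

Section Gamma.
Variables (K : cartCat) (dag : daggerOp K) (Q : automaton).

(* states and letters identified with 'I_n and 'I_m via enumeration *)
Local Notation n := #|st Q|.
Local Notation m := #|al Q|.

Definition rho (A : K) (i : 'I_n) : Hom (pw A n) (pw A m) :=
  tup (fun j : 'I_m => proj (enum_rank (act (enum_val i) (enum_val j)))).

Definition fQ (A C : K) (f : Hom (prod (pw A m) C) A) :
    Hom (prod (pw A n) C) (pw A n) :=
  tup (fun i : 'I_n => comp f (pmap (rho A i) (idm C))).

Definition Gamma : Prop :=
  forall (A C : K) (f : Hom (prod (pw A m) C) A),
    @dag (pw A n) C (fQ f)
    = comp (diag A n) (@dag A C (comp f (pmap (diag A m) (idm C)))).

Definition Gamma_init (q : st Q) : Prop :=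
  forall (A C : K) (f : Hom (prod (pw A m) C) A),
    comp (proj (enum_rank q)) (@dag (pw A n) C (fQ f))
    = @dag A C (comp f (pmap (diag A m) (idm C))).

End Gamma.

Lemma group_card_gt0 (G : finGroupType) : 0 < #|G|.
Proof. by apply/card_gt0P; exists 1%g. Qed.

Definition group_automaton (G : finGroupType) : automaton :=
  @Automaton G G (fun x y => (x * y)%g) (group_card_gt0 G) (group_card_gt0 G).

Definition Gamma_group (K : cartCat) (dag : daggerOp K) (G : finGroupType) : Prop :=
  Gamma dag (group_automaton G).

(* Main.v *)
From HB Require Import structures.
From mathcomp Require Import all_boot all_fingroup gseries.
Require Import Defs.

Set Implicit Arguments.
Unset Strict Implicit.
Unset Printing Implicit Defensive.

(* Applied to the objects A^P, the identity Gamma(Q, q) says that a system of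
   fixed point equations x_(q,p) = G_p(x_(qz,p')) has the same solution at q as
   the system in which Q is replaced by an automaton with one state. In this
   form the identities pass to subautomata, quotients, cascade products,
   successor states, and alphabets of nonempty words, by solving subsystems
   separately. Hence Gamma(Q, q) gives Gamma(G) for every nontrivial G dividing
   M(Q).

   Conversely, if some letter c of Q is not a permutation, the double dagger
   identity separates the occurrences of c from those of the other letters:
   Gamma of the monoid generated by the latter solves the equations for them,
   and what is left is a system over the smaller state set Qc. This replaces the
   Krohn-Rhodes decomposition; the induction ends at permutation automata, hence
   at groups, which are reduced to their composition factors by cascade
   products. *)

Section Cartesian.
Variable K : cartCat.
Implicit Types A B C X : K.

Lemma comp_pair X Y A B (f : @Hom K X A) (g : Hom X B) (h : Hom Y X) :
  comp (pair f g) h = pair (comp f h) (comp g h).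
Proof. by rewrite [LHS]pair_uniq !comp_assoc pi1_pair pi2_pair. Qed.

Lemma pair_pi A B : pair (pi1 A B) (pi2 A B) = idm (prod A B).
Proof. by rewrite [RHS]pair_uniq !comp_id_r. Qed.

Lemma comp_pmap X A B A' B' (f : @Hom K A A') (g : Hom B B')
    (a : Hom X A) (b : Hom X B) :
  comp (pmap f g) (pair a b) = pair (comp f a) (comp g b).
Proof. by rewrite /pmap comp_pair -!comp_assoc pi1_pair pi2_pair. Qed.

Lemma eq_tupS X A k (fs gs : 'I_k.+1 -> Hom X A) :
  fs =1 gs -> tupS fs = tupS gs.
Proof.
elim: k fs gs => [|k IHk] fs gs eq_fg /=; first exact: eq_fg.
by rewrite eq_fg; congr pair; apply: IHk => i.
Qed.

Lemma projS_tupS X A k (fs : 'I_k.+1 -> Hom X A) i :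
  comp (projS A i) (tupS fs) = fs i.
Proof.
elim: k fs i => [|k IHk] fs i /=; first by rewrite comp_id_l (ord1 i).
by case: unliftP => [j|] ->; rewrite -?comp_assoc ?pi1_pair // pi2_pair IHk.
Qed.

Lemma tupS_projS X A k (h : Hom X (powS A k)) :
  tupS (fun i => comp (projS A i) h) = h.
Proof.
elim: k h => [|k IHk] h /=; first by rewrite comp_id_l.
rewrite [RHS]pair_uniq -[comp (pi2 _ _) h in RHS]IHk unlift_none.
by congr pair; apply: eq_tupS => i; rewrite liftK comp_assoc.
Qed.

Lemma eq_tup n X A (fs gs : 'I_n -> Hom X A) : fs =1 gs -> tup fs = tup gs.
Proof. by case: n fs gs => [//|n] fs gs; apply: eq_tupS. Qed.

Lemma proj_tup n X A (fs : 'I_n -> Hom X A) i : comp (proj i) (tup fs) = fs i.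
Proof. by case: n fs i => [fs [] //|n] fs i; apply: projS_tupS. Qed.

Lemma tup_proj n X A (h : Hom X (pw A n)) : tup (fun i => comp (proj i) h) = h.
Proof. by case: n h => [|n] h; [rewrite [h]bang_uniq | apply: tupS_projS]. Qed.

Definition fpow (I : finType) A : K := pw A #|I|.

Definition ftup (I : finType) X A (v : I -> Hom X A) : Hom X (fpow I A) :=
  tup (fun i => v (enum_val i)).

Definition fproj (I : finType) A (i : I) : Hom (fpow I A) A :=
  proj (enum_rank i).

Section Families.
Variable I : finType.

Lemma eq_ftup X A (v w : I -> Hom X A) : v =1 w -> ftup v = ftup w.
Proof. by move=> eq_vw; apply: eq_tup. Qed.

Lemma fproj_ftup X A (v : I -> Hom X A) i : comp (fproj A i) (ftup v) = v i.
Proof. by rewrite /fproj /ftup proj_tup enum_rankK. Qed.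

Lemma ftup_fproj X A (h : Hom X (fpow I A)) :
  ftup (fun i => comp (fproj A i) h) = h.
Proof.
by rewrite -[RHS]tup_proj; apply: eq_tup => i; rewrite /fproj enum_valK.
Qed.

Lemma fpow_ext X A (f g : Hom X (fpow I A)) :
  (forall i, comp (fproj A i) f = comp (fproj A i) g) -> f = g.
Proof.
by move=> eq_fg; rewrite -[f]ftup_fproj -[g]ftup_fproj; apply: eq_ftup.
Qed.

Lemma comp_ftup X Y A (v : I -> Hom X A) (h : Hom Y X) :
  comp (ftup v) h = ftup (fun i => comp (v i) h).
Proof. by apply: fpow_ext => i; rewrite comp_assoc !fproj_ftup. Qed.

End Families.

Lemma ftup_const (I : finType) A : ftup (fun _ : I => idm A) = diag A #|I|.
Proof. by []. Qed.

End Cartesian.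

Arguments fpow {K} I A.
Arguments ftup {K I X A}.
Arguments fproj {K I A}.

(* A morphism [F : A^I * C -> B] is read as a term in the variables [i : I] and
   a parameter of type [C]; [subst F v c] puts [v i] for [i] and [c] for the
   parameter. *)
Section Terms.
Variable K : cartCat.
Implicit Types (A B C X Y : K) (I J L : finType).

Definition var I A C (i : I) : Hom (prod (fpow I A) C) A :=
  comp (fproj i) (pi1 _ _).

Definition weaken I A B C (h : Hom C B) : Hom (prod (fpow I A) C) B :=
  comp h (pi2 _ _).

Definition subst I X A B C (F : Hom (prod (fpow I A) C) B)
    (v : I -> Hom X A) (c : Hom X C) : Hom X B :=
  comp F (pair (ftup v) c).

Definition reindex I J A B C (s : J -> I) (F : Hom (prod (fpow J A) C) B) :
    Hom (prod (fpow I A) C) B :=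
  subst F (fun j => var A C (s j)) (pi2 _ _).

Lemma eq_subst I X A B C (F : Hom (prod (fpow I A) C) B)
    (v w : I -> Hom X A) (c : Hom X C) :
  v =1 w -> subst F v c = subst F w c.
Proof. by move=> eq_vw; rewrite /subst (eq_ftup eq_vw). Qed.

Lemma comp_subst I X Y A B C (F : Hom (prod (fpow I A) C) B)
    (v : I -> Hom X A) (c : Hom X C) (h : Hom Y X) :
  comp (subst F v c) h = subst F (fun i => comp (v i) h) (comp c h).
Proof. by rewrite /subst -comp_assoc comp_pair comp_ftup. Qed.

Lemma subst_comp I X A B B' C (g : Hom B B') (F : Hom (prod (fpow I A) C) B)
    (v : I -> Hom X A) (c : Hom X C) :
  subst (comp g F) v c = comp g (subst F v c).
Proof. by rewrite /subst comp_assoc. Qed.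

Section Substitution.
Variables (I : finType) (X A C : K) (v : I -> Hom X A) (c : Hom X C).

Lemma subst_var i : subst (var A C i) v c = v i.
Proof. by rewrite /subst -comp_assoc pi1_pair fproj_ftup. Qed.

Lemma subst_pi2 : subst (pi2 _ _) v c = c.
Proof. exact: pi2_pair. Qed.

Lemma subst_weaken B (h : Hom C B) : subst (weaken I A h) v c = comp h c.
Proof. by rewrite subst_comp subst_pi2. Qed.

Lemma subst_subst J A' B C' (F : Hom (prod (fpow J A') C') B)
    (w : J -> Hom (prod (fpow I A) C) A') (e : Hom (prod (fpow I A) C) C') :
  subst (subst F w e) v c = subst F (fun j => subst (w j) v c) (subst e v c).
Proof. exact: comp_subst. Qed.

Lemma subst_reindex J B (s : J -> I) (F : Hom (prod (fpow J A) C) B) :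
  subst (reindex s F) v c = subst F (fun j => v (s j)) c.
Proof.
by rewrite subst_subst subst_pi2; apply: eq_subst => j; rewrite subst_var.
Qed.

End Substitution.

Lemma subst_var_pi2 I A B C (F : Hom (prod (fpow I A) C) B) :
  subst F (var A C) (pi2 _ _) = F.
Proof.
by rewrite /subst [ftup (var A C)]ftup_fproj pair_pi comp_id_r.
Qed.

Lemma subst_ext I A B C (F G : Hom (prod (fpow I A) C) B) :
  (forall X (v : I -> Hom X A) (c : Hom X C), subst F v c = subst G v c) ->
  F = G.
Proof. by move/(_ _ (var A C) (pi2 _ _)); rewrite !subst_var_pi2. Qed.

Lemma reindex_var I J A C (s : J -> I) j :
  reindex s (var A C j) = var A C (s j).
Proof. exact: subst_var. Qed.

Lemma reindex_comp I J L A B C (s : J -> I) (t : L -> J)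
    (F : Hom (prod (fpow L A) C) B) :
  reindex s (reindex t F) = reindex (fun l => s (t l)) F.
Proof. exact: subst_reindex. Qed.

Lemma eq_reindex I J A B C (s t : J -> I) (F : Hom (prod (fpow J A) C) B) :
  s =1 t -> reindex s F = reindex t F.
Proof. by move=> eq_st; apply: eq_subst => j; rewrite eq_st. Qed.

(* The shape to which the double dagger identity applies: the variables [l]
   with [s l = inl i] become inner ones, those with [s l = inr j] outer ones. *)
Definition layer I J L A B C (s : L -> I + J) (F : Hom (prod (fpow L A) C) B) :
    Hom (prod (fpow I A) (prod (fpow J A) C)) B :=
  subst F (fun l => match s l with
                    | inl i => var A _ i
                    | inr j => weaken I A (var A C j)
                    end)
    (weaken I A (pi2 _ _)).

Lemma subst_layer I J L X A B C (s : L -> I + J)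
    (F : Hom (prod (fpow L A) C) B) (u : I -> Hom X A)
    (e : Hom X (prod (fpow J A) C)) :
  subst (layer s F) u e =
  subst F (fun l => match s l with
                    | inl i => u i
                    | inr j => comp (var A C j) e
                    end)
    (comp (pi2 _ _) e).
Proof.
rewrite subst_subst subst_weaken; apply: eq_subst => l.
by case: (s l) => [i|j]; rewrite (subst_var, subst_weaken).
Qed.

Lemma reindex_layer I I' J L A B C (s : L -> I + J) (t : I -> I')
    (F : Hom (prod (fpow L A) C) B) :
  reindex t (layer s F) =
  layer (fun l => match s l with inl i => inl (t i) | inr j => inr j end) F.
Proof.
rewrite [LHS]subst_layer; apply: eq_subst => l.
by case: (s l).
Qed.

End Terms.

Arguments var {K I A C}.
Arguments weaken {K I A B C}.

Section Conway.
Variables (K : cartCat) (dag : daggerOp K) (HK : conway dag).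
Implicit Types (A B C E : K) (I J L : finType).

Lemma dag_param A B C (f : Hom (prod A B) A) (g : Hom C B) :
  dag (comp f (pmap (idm A) g)) = comp (dag f) g.
Proof. by case: HK => + _; apply. Qed.

Lemma dag_double A C (f : Hom (prod A (prod A C)) A) :
  dag (dag f) = dag (comp f (pair (pi1 A C) (idm _))).
Proof. by rewrite -pair_pi; case: HK => _ [+ _]; apply. Qed.

Lemma dag_comp A B C (f : Hom (prod B C) A) (g : Hom (prod A C) B) :
  dag (comp f (pair g (pi2 A C)))
  = comp f (pair (dag (comp g (pair f (pi2 B C)))) (idm C)).
Proof. by case: HK => _ [_]; apply. Qed.

Lemma dag_fix A C (f : Hom (prod A C) A) :
  dag f = comp f (pair (dag f) (idm C)).
Proof.
have := dag_comp f (pi1 A C).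
by rewrite pair_pi comp_id_r pi1_pair.
Qed.

(* [get] reads and [put] overwrites a part [B] of [E]. If that part evolves
   autonomously under [f], it can be solved first: [f] is the diagonal of a
   map whose inner dagger is computed by [dag_comp]. *)
Lemma dag_lens E B C (get : Hom E B) (put : Hom (prod B E) E)
    (f : Hom (prod E C) E) (g : Hom (prod B C) B) :
  comp get put = pi1 B E -> comp put (pair get (idm E)) = idm E ->
  comp get f = comp g (pmap get (idm C)) ->
  comp get (dag f) = dag g.
Proof.
move=> get_put put_get get_f.
pose g' := comp g (pair (pi1 B (prod E C)) (comp (pi2 E C) (pi2 B _))).
pose put_f : Hom (prod B (prod E C)) E := comp put (pair g' (comp f (pi2 _ _))).
pose k := comp put_f (pair (comp get (pi1 E (prod E C))) (pi2 _ _)).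
have g'_get : comp g' (pair (comp get (pi1 E C)) (idm _)) = comp get f.
  rewrite get_f /g' -comp_assoc comp_pair -comp_assoc pi1_pair pi2_pair.
  by rewrite comp_id_r /pmap comp_id_l.
have diag_k : comp k (pair (pi1 E C) (idm (prod E C))) = f.
  rewrite /k -comp_assoc comp_pair -comp_assoc pi1_pair pi2_pair.
  rewrite /put_f -comp_assoc comp_pair -comp_assoc pi2_pair comp_id_r g'_get.
  by rewrite -{2}(comp_id_l f) -comp_pair comp_assoc put_get comp_id_l.
have get_put_f : comp get put_f = g'.
  by rewrite /put_f comp_assoc get_put pi1_pair.
have get_k : comp get (dag k) = comp (dag g) (pi2 E C).
  rewrite /k dag_comp -(comp_assoc get (pi1 _ _)) pi1_pair.
  rewrite (comp_assoc get put_f) !get_put_f -dag_fix -dag_param.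
  by rewrite /pmap comp_id_l.
rewrite -diag_k -dag_double dag_fix comp_assoc get_k.
by rewrite -comp_assoc pi2_pair comp_id_r.
Qed.

Section Solutions.
Variable I : finType.

Definition sol A C (F : I -> Hom (prod (fpow I A) C) A) (i : I) : Hom C A :=
  comp (fproj i) (dag (ftup F)).

Lemma ftup_sol A C (F : I -> Hom (prod (fpow I A) C) A) :
  ftup (sol F) = dag (ftup F).
Proof. exact: ftup_fproj. Qed.

Lemma eq_sol A C (F F' : I -> Hom (prod (fpow I A) C) A) :
  F =1 F' -> sol F =1 sol F'.
Proof. by move=> eqF i; rewrite /sol (eq_ftup eqF). Qed.

Lemma sol_fix A C (F : I -> Hom (prod (fpow I A) C) A) i :
  sol F i = subst (F i) (sol F) (idm C).
Proof. by rewrite /subst ftup_sol /sol {1}dag_fix comp_assoc fproj_ftup. Qed.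

Lemma sol_param A B C (F : I -> Hom (prod (fpow I A) B) A) (g : Hom C B) i :
  sol (fun i => subst (F i) var (weaken g)) i = comp (sol F i) g.
Proof.
rewrite /sol -comp_assoc -dag_param comp_ftup; congr (comp _ (dag (ftup _))).
by rewrite /subst [ftup var]ftup_fproj /pmap comp_id_l.
Qed.

Lemma sol_double A C
    (F : I -> Hom (prod (fpow I A) (prod (fpow I A) C)) A) :
  sol (sol F) =1 sol (fun i => subst (F i) var (idm _)).
Proof.
move=> i; rewrite /sol ftup_fproj dag_double comp_ftup.
by rewrite /subst [ftup var]ftup_fproj.
Qed.

Lemma sol_layer L A C (s : I -> L -> I + I)
    (F : I -> Hom (prod (fpow L A) C) A) :
  sol (sol (fun i => layer (s i) (F i))) =1
  sol (fun i =>
    reindex (fun l => match s i l with inl j | inr j => j end) (F i)).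
Proof.
move=> i; rewrite sol_double; apply: eq_sol => j; rewrite subst_layer comp_id_r.
by apply: eq_subst => l; case: (s j l) => ?; rewrite ?comp_id_r.
Qed.

Lemma sol_layer_outer J J' L A C (s : I -> L -> I + J) (t : J -> J')
    (F : I -> Hom (prod (fpow L A) C) A) i :
  sol (fun i => layer (fun l => match s i l with
                                | inl i' => inl i'
                                | inr j => inr (t j)
                                end) (F i)) i
  = reindex t (sol (fun i => layer (s i) (F i)) i).
Proof.
rewrite -[RHS]sol_param; apply: eq_sol => {}i; rewrite subst_layer.
rewrite /weaken comp_assoc pi2_pair; apply: eq_subst => l.
case: (s i l) => // j.
by rewrite comp_assoc -[comp (var j) _]/(subst _ _ _) subst_var.
Qed.

End Solutions.

Lemma sol_subsystem I J (s : J -> I) A C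
    (F : I -> Hom (prod (fpow I A) C) A)
    (G : J -> Hom (prod (fpow J A) C) A) j :
  injective s -> (forall j, F (s j) = reindex s (G j)) ->
  sol F (s j) = sol G j.
Proof.
move=> s_inj FG.
pose get : Hom (fpow I A) (fpow J A) := ftup (fun j => fproj (s j)).
pose put : Hom (prod (fpow J A) (fpow I A)) (fpow I A) :=
  ftup (fun i => if [pick j | s j == i] is Some j then var j
                 else weaken (fproj i)).
have get_j j' : comp (fproj j') get = fproj (s j') by rewrite fproj_ftup.
have put_s j' : comp (fproj (s j')) put = var j'.
  rewrite fproj_ftup; case: pickP => [j'' /eqP/s_inj -> //|/(_ j')].
  by rewrite eqxx.
rewrite {2}/sol -(@dag_lens (fpow I A) (fpow J A) C get put (ftup F)).
- by rewrite comp_assoc get_j.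
- by apply: fpow_ext => j'; rewrite comp_assoc get_j put_s.
- apply: fpow_ext => i; rewrite comp_assoc fproj_ftup comp_id_r.
  case: pickP => [j' /eqP <-|_].
    by rewrite -comp_assoc pi1_pair get_j.
  by rewrite -comp_assoc pi2_pair comp_id_r.
- apply: fpow_ext => j'; rewrite !comp_assoc get_j !fproj_ftup FG.
  by rewrite /reindex /subst /pmap comp_id_l comp_ftup.
Qed.

Lemma sol_curry I J A C (F : I -> Hom (prod (fpow I (fpow J A)) C) (fpow J A))
    (G : I * J -> Hom (prod (fpow (I * J)%type A) C) A) i j :
  (forall X (v : I * J -> Hom X A) (c : Hom X C) i j,
     comp (fproj j) (subst (F i) (fun i => ftup (fun j => v (i, j))) c)
     = subst (G (i, j)) v c) ->
  comp (fproj j) (sol F i) = sol G (i, j).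
Proof.
move=> FG.
pose uncurry : Hom (fpow I (fpow J A)) (fpow (I * J)%type A) :=
  ftup (fun ij => comp (fproj ij.2) (fproj ij.1)).
pose curry : Hom (prod (fpow (I * J)%type A) (fpow I (fpow J A)))
                 (fpow I (fpow J A)) :=
  ftup (fun i => ftup (fun j => var (i, j))).
have uncurryE ij : comp (fproj ij) uncurry = comp (fproj ij.2) (fproj ij.1).
  by rewrite fproj_ftup.
have curryE i' j' : comp (fproj j') (comp (fproj i') curry) = var (i', j').
  by rewrite !fproj_ftup.
rewrite {2}/sol -(@dag_lens _ _ C uncurry curry (ftup F)).
- by rewrite [RHS]comp_assoc uncurryE -comp_assoc.
- apply: fpow_ext => -[i' j'].
  by rewrite comp_assoc uncurryE -comp_assoc curryE.
- apply: fpow_ext => i'; apply: fpow_ext => j'.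
  rewrite (comp_assoc (fproj i')) comp_assoc curryE /var -comp_assoc pi1_pair.
  by rewrite uncurryE comp_id_r.
- apply: subst_ext => X v c; apply: fpow_ext => -[i' j'].
  rewrite !subst_comp comp_assoc uncurryE -comp_assoc -subst_comp fproj_ftup.
  have ftup_v : v =1 fun i => ftup (fun j => comp (fproj j) (v i)).
    by move=> i''; rewrite ftup_fproj.
  rewrite (eq_subst _ _ ftup_v) (FG _ (fun ij => comp (fproj ij.2) (v ij.1))).
  rewrite comp_assoc fproj_ftup {2}/subst comp_pmap comp_id_l comp_ftup.
  by apply: eq_subst => ij; rewrite -comp_assoc fproj_ftup.
Qed.

Lemma sol_unit A C (F : unit -> Hom (prod (fpow unit A) C) A) :
  sol F tt = dag (subst (F tt) (fun _ => pi1 A C) (pi2 A C)).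
Proof.
apply: (dag_lens (put := ftup (fun _ => pi1 _ _))).
- by rewrite fproj_ftup.
- by apply: fpow_ext => -[]; rewrite comp_assoc fproj_ftup pi1_pair comp_id_r.
- apply: subst_ext => X v c; rewrite fproj_ftup.
  rewrite -[comp _ (pmap _ _)]/(comp (subst _ _ _) _) comp_subst.
  rewrite /pmap pi1_pair pi2_pair comp_id_l subst_subst subst_pi2.
  by apply: eq_subst => -[]; rewrite [RHS]subst_var.
Qed.

(* Solving first for the equations [x_i = x_(r i)]. *)
Lemma sol_eliminate I A C (F : I -> Hom (prod (fpow I A) C) A) (r : I -> I) :
  (forall i, r (r i) = r i) -> (forall i, r i != i -> F i = var (r i)) ->
  sol F =1 sol (fun i => reindex r (F i)).
Proof.
move=> r_idem F_var.
pose s i j : I + I := if (r i == i) && (r j != j) then inl j else inr j.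
pose inner := sol (fun i => layer (s i) (F i)).
have innerE i :
    inner i = subst (F i) (fun j => if (r i == i) && (r j != j) then inner j
                                    else var j) (pi2 _ _).
  rewrite /inner sol_fix subst_layer comp_id_r; apply: eq_subst => j.
  by rewrite /s; case: ifP => _ //; rewrite comp_id_r.
have inner_var i : r i != i -> inner i = var (r i).
  by move=> ri; rewrite innerE (negPf ri) subst_var_pi2 F_var.
have diag_s i :
    reindex (fun l => match s i l with inl j | inr j => j end) (F i) = F i.
  rewrite -[RHS]subst_var_pi2; apply: eq_subst => j.
  by rewrite /s; case: ifP.
move=> i; rewrite -(eq_sol diag_s) -sol_layer; apply: eq_sol => {}i.
have [ri|ri] := eqVneq (r i) i; last first.
  by rewrite -/inner inner_var // F_var // reindex_var r_idem.
rewrite -/inner innerE ri eqxx; apply: eq_subst => j.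
by have [->|/inner_var] := eqVneq (r j) j.
Qed.

End Conway.

Section Systems.
Variables (K : cartCat) (dag : daggerOp K) (HK : conway dag).
Implicit Types (A C : K) (I P Q Z B D N : finType).

Local Notation family P Z A C := (P -> Hom (prod (fpow (Z * P)%type A) C) A).

(* The system of equations [x_(q,p) = G_p (x_(d q z,p') : (z, p') in Z * P)]. *)
Definition sys Q Z (d : Q -> Z -> Q) P A C (G : family P Z A C) (qp : Q * P) :
    Hom (prod (fpow (Q * P)%type A) C) A :=
  reindex (fun zp => (d qp.1 zp.1, zp.2)) (G qp.2).

Definition one_state Z (_ : unit) (_ : Z) : unit := tt.

(* The vector form of Gamma(Q, q), that is, [Gamma_init] for objects [A^P]. *)
Definition vGamma Q Z (d : Q -> Z -> Q) (q : Q) : Prop :=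
  forall A C P (G : family P Z A C) p,
    sol dag (sys d G) (q, p) = sol dag (sys (@one_state Z) G) (tt, p).

Definition bundle Z A C P (G : family P Z A C) :
    Hom (prod (fpow Z (fpow P A)) C) (fpow P A) :=
  ftup (fun p =>
    subst (G p) (fun zp => comp (fproj zp.2) (var zp.1)) (pi2 _ _)).

Lemma sol_sys_bundle Q Z (d : Q -> Z -> Q) A C P (G : family P Z A C) q p :
  comp (fproj p) (sol dag (fun q => reindex (d q) (bundle G)) q)
  = sol dag (sys d G) (q, p).
Proof.
apply: sol_curry => // X v c {}q {}p.
rewrite subst_reindex -subst_comp fproj_ftup subst_subst subst_pi2.
rewrite subst_reindex; apply: eq_subst => zp.
by rewrite subst_comp subst_var fproj_ftup.
Qed.

Lemma sol_sys_unit Q Z (d : Q -> Z -> Q) A C (f : Hom (prod (fpow Z A) C) A) q :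
  sol dag (sys d (fun _ : unit => reindex (fun z => (z, tt)) f)) (q, tt)
  = sol dag (fun q => reindex (d q) f) q.
Proof.
apply: (sol_subsystem HK (s := fun q => (q, tt))) => [? ? []//|{}q].
by rewrite /sys !reindex_comp.
Qed.

Lemma Gamma_initP (Q : automaton) (q : st Q) :
  Gamma_init dag q <->
  forall A C (f : Hom (prod (fpow (al Q) A) C) A),
    sol dag (fun q => reindex (@act Q q) f) q
    = sol dag (fun u : unit => reindex (one_state u) f) tt.
Proof.
have solE A C f :
    comp (proj (enum_rank q)) (dag (@fQ K Q A C f))
    = sol dag (fun q => reindex (@act Q q) f) q.
  congr (comp _ (dag _)); apply: eq_tup => i.
  rewrite /reindex /subst -(comp_ftup (fun z => fproj (act (enum_val i) z))).
  by rewrite /pmap comp_id_l.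
have one_stateE A C f : dag (comp f (pmap (diag A #|al Q|) (idm C)))
    = sol dag (fun u : unit => reindex (one_state u) f) tt.
  rewrite sol_unit // subst_reindex /pmap comp_id_l -ftup_const comp_ftup.
  by congr (dag (comp _ (pair _ _))); apply: eq_ftup => z; rewrite comp_id_l.
by split=> eq_sols A C f; have := eq_sols A C f; rewrite solE one_stateE.
Qed.

Lemma Gamma_init_vGamma (Q : automaton) (q : st Q) :
  Gamma_init dag q <-> vGamma (@act Q) q.
Proof.
apply: (iff_trans (Gamma_initP q)); split=> [eq_sols A C P G p|Gq A C f].
  by rewrite -!sol_sys_bundle eq_sols.
by rewrite -sol_sys_unit Gq sol_sys_unit.
Qed.

Lemma Gamma_forall_init (Q : automaton) :
  Gamma dag Q <-> forall q : st Q, Gamma_init dag q.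
Proof.
have proj_diag A (i : 'I_#|st Q|) : comp (proj i) (diag A #|st Q|) = idm A.
  exact: proj_tup.
split=> [GQ q A C f|GQ A C f].
  by rewrite GQ comp_assoc proj_diag comp_id_l.
rewrite -[LHS]tup_proj -[RHS]tup_proj; apply: eq_tup => i.
by rewrite comp_assoc proj_diag comp_id_l -(GQ (enum_val i)) enum_valK.
Qed.

Lemma vGamma_letters Q Z Z' (d : Q -> Z -> Q) (d' : Q -> Z' -> Q)
    (f : Z' -> Z) q :
  (forall q z, d' q z = d q (f z)) -> vGamma d q -> vGamma d' q.
Proof.
move=> d'E Gq A C P G p.
pose G' p := reindex (fun zp => (f zp.1, zp.2)) (G p).
have -> : sol dag (sys d' G) (q, p) = sol dag (sys d G') (q, p).
  apply: eq_sol => -[q' p']; rewrite /sys reindex_comp.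
  by apply: eq_reindex => zp; rewrite /= d'E.
by rewrite Gq; apply: eq_sol => -[u p']; rewrite /sys reindex_comp.
Qed.

Lemma eq_vGamma Q Z (d d' : Q -> Z -> Q) q :
  (forall q z, d' q z = d q z) -> vGamma d q -> vGamma d' q.
Proof. exact: vGamma_letters. Qed.

Lemma sol_sys_subautomaton Q Q' Z (d : Q -> Z -> Q) (d' : Q' -> Z -> Q')
    (i : Q' -> Q) A C P (G : family P Z A C) q p :
  injective i -> (forall q z, i (d' q z) = d (i q) z) ->
  sol dag (sys d G) (i q, p) = sol dag (sys d' G) (q, p).
Proof.
move=> i_inj i_act.
apply: (sol_subsystem HK (s := fun qp => (i qp.1, qp.2)) (q, p)).
  by move=> [q1 p1] [q2 p2] [/i_inj -> ->].
move=> [q' p']; rewrite /sys reindex_comp.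
by apply: eq_reindex => zp; rewrite /= i_act.
Qed.

Lemma vGamma_subautomaton Q Q' Z (d : Q -> Z -> Q) (d' : Q' -> Z -> Q')
    (i : Q' -> Q) q :
  injective i -> (forall q z, i (d' q z) = d (i q) z) ->
  vGamma d (i q) <-> vGamma d' q.
Proof.
move=> i_inj i_act; split=> Gq A C P G p;
  by rewrite -Gq (sol_sys_subautomaton _ _ _ i_inj i_act).
Qed.

Lemma vGamma_trivial Q Z (q : Q) : vGamma (fun q (_ : Z) => q) q.
Proof.
move=> A C P G p.
by apply: (sol_sys_subautomaton (i := fun=> q)) => // -[] [].
Qed.

Section Cascade.
Variables (Q1 Q2 Z1 Z2 : finType).
Variables (d1 : Q1 -> Z1 -> Q1) (d2 : Q2 -> Z2 -> Q2) (f : Q1 -> Z1 -> Z2).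

Definition cascade (q : Q1 * Q2) (z : Z1) : Q1 * Q2 :=
  (d1 q.1 z, d2 q.2 (f q.1 z)).

Definition cascade_family A C P (G : family P Z1 A C) (qp : Q1 * P) :
    Hom (prod (fpow (Z2 * (Q1 * P))%type A) C) A :=
  reindex (fun zp => (f qp.1 zp.1, (d1 qp.1 zp.1, zp.2))) (G qp.2).

Lemma sol_sys_cascade A C P (G : family P Z1 A C) q1 q2 p :
  sol dag (sys d2 (cascade_family G)) (q2, (q1, p))
  = sol dag (sys cascade G) ((q1, q2), p).
Proof.
apply: (sol_subsystem HK (s := fun qp => (qp.1.2, (qp.1.1, qp.2))) (q1, q2, p)).
  by move=> [[? ?] ?] [[? ?] ?] [-> -> ->].
by move=> [[q1' q2'] p']; rewrite /sys !reindex_comp.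
Qed.

End Cascade.

Lemma vGamma_cascade Q1 Q2 Z1 Z2 (d1 : Q1 -> Z1 -> Q1) (d2 : Q2 -> Z2 -> Q2)
    (f : Q1 -> Z1 -> Z2) q :
  vGamma d1 q.1 -> vGamma d2 q.2 -> vGamma (cascade d1 d2 f) q.
Proof.
case: q => q1 q2 /= Gq1 Gq2 A C P G p.
rewrite -sol_sys_cascade Gq2 sol_sys_cascade -Gq1.
by apply: (sol_sys_subautomaton (i := fun q => (q, tt))) => // ? ? [].
Qed.

(* Run [d'] first and [d] second: by Gamma(d, q) the first component does not
   notice the second one, and the graph of [h] is a copy of [d] in the
   product. *)
Lemma vGamma_quotient Q Q' Z (d : Q -> Z -> Q) (d' : Q' -> Z -> Q')
    (h : Q -> Q') q :
  (forall q z, h (d q z) = d' (h q) z) -> vGamma d q -> vGamma d' (h q).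
Proof.
move=> h_act Gq A C P G p; pose d'1 := cascade d' (@one_state Z) (fun=> id).
transitivity (sol dag (sys d'1 G) (h q, tt, p)).
  symmetry.
  by apply: (sol_sys_subautomaton (i := fun q => (q, tt))) => // ? ? [].
rewrite -sol_sys_cascade -!Gq sol_sys_cascade.
apply: (sol_sys_subautomaton (i := fun q => (h q, q))) => [? ? []//|? ?].
by rewrite h_act.
Qed.

Lemma vGamma_unfold Q Z (d : Q -> Z -> Q) q :
  (forall z, vGamma d (d q z)) -> vGamma d q.
Proof.
move=> Gqz A C P G p; rewrite !sol_fix // !subst_reindex.
by apply: eq_subst => zp; apply: Gqz.
Qed.

Section Successor.
Variables (Z : finType) (a : Z).

Definition delay_family A C P (G : family P Z A C) (p : P + P) :
    Hom (prod (fpow (Z * (P + P))%type A) C) A :=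
  match p with
  | inl p => reindex (fun zp => (zp.1, inl zp.2)) (G p)
  | inr p => var (a, inl p)
  end.

Lemma sol_sys_delay Q (d : Q -> Z -> Q) A C P (G : family P Z A C) q p :
  sol dag (sys d (delay_family G)) (q, inr p) = sol dag (sys d G) (d q a, p).
Proof.
rewrite sol_fix // subst_reindex subst_var.
apply: (sol_subsystem HK (s := fun qp => (qp.1, inl qp.2)) (d q a, p)).
  by move=> [? ?] [? ?] [-> ->].
by move=> [q' p']; rewrite /sys !reindex_comp.
Qed.

Lemma vGamma_succ Q (d : Q -> Z -> Q) q : vGamma d q -> vGamma d (d q a).
Proof. by move=> Gq A C P G p; rewrite -sol_sys_delay Gq sol_sys_delay. Qed.

End Successor.

Lemma vGamma_foldl Q Z (d : Q -> Z -> Q) q u :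
  vGamma d q -> vGamma d (foldl d q u).
Proof. by elim: u q => //= z u IHu q /(vGamma_succ z)/IHu. Qed.

Section PairsOfLetters.
Variable Z : finType.

Definition act_pair Q (d : Q -> Z -> Q) q (zz : Z * option Z) : Q :=
  oapp (d (d q zz.1)) (d q zz.1) zz.2.

Definition relay_family A C P (G : family P (Z * option Z)%type A C)
    (p : P + Z * P) : Hom (prod (fpow (Z * (P + Z * P))%type A) C) A :=
  match p with
  | inl p => reindex (fun zp =>
      (zp.1.1, oapp (fun z => inr (z, zp.2)) (inl zp.2) zp.1.2)) (G p)
  | inr (z, p) => var (z, inl p)
  end.

Lemma sol_sys_pair Q (d : Q -> Z -> Q) A C P
    (G : family P (Z * option Z)%type A C) q p :
  sol dag (sys d (relay_family G)) (q, inl p)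
  = sol dag (sys (act_pair d) G) (q, p).
Proof.
pose r (qp : Q * (P + Z * P)) : Q * (P + Z * P) :=
  match qp with (q, inl _) => qp | (q, inr (z, p)) => (d q z, inl p) end.
rewrite (sol_eliminate HK (r := r)); first last.
- move=> [q' [p'|[z p']]] /=; first by rewrite eqxx.
  by move=> _; apply: reindex_var.
- by move=> [q' [p'|[z p']]].
apply: (sol_subsystem HK (s := fun qp => (qp.1, inl qp.2)) (q, p)).
  by move=> [? ?] [? ?] [-> ->].
move=> [q' p']; rewrite /sys !reindex_comp.
by apply: eq_reindex => -[[z [z'|]] p''].
Qed.

Lemma vGamma_pair Q (d : Q -> Z -> Q) q : vGamma d q -> vGamma (act_pair d) q.
Proof.
move=> Gq A C P G p; rewrite -sol_sys_pair Gq sol_sys_pair.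
by apply: eq_sol => -[[] p']; apply: eq_reindex => -[[z [z'|]] p''].
Qed.

End PairsOfLetters.

Lemma vGamma_words Q Z Z' (d : Q -> Z -> Q) (w : Z' -> seq Z) q :
  (forall z, 0 < size (w z)) -> vGamma d q ->
  vGamma (fun q z => foldl d q (w z)) q.
Proof.
move=> w_gt0 Gq.
have [k le_wk] : exists k, forall z, size (w z) <= k.+1.
  by exists (\max_z size (w z)) => z; apply/leqW/leq_bigmax.
elim: k Z' w w_gt0 le_wk => [|k IHk] Z' w w_gt0 le_wk.
  have /fin_all_exists[a wE] z : exists a, w z = [:: a].
    by have := w_gt0 z; have := le_wk z; case: (w z) => [|a []] //; exists a.
  by apply: (vGamma_letters (f := a)) Gq => q' z; rewrite wE.
pose w' (z : Z + Z') : seq Z :=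
  match z with inl z => [:: z] | inr z => take k.+1 (w z) end.
have /vGamma_pair : vGamma (fun q z => foldl d q (w' z)) q.
  apply: IHk => -[z|z] //=; rewrite size_take; case: ifP => //.
  by move/negbT; rewrite -leqNgt.
pose f z : (Z + Z') * option (Z + Z') :=
  (inr z, omap inl (ohead (drop k.+1 (w z)))).
apply: (vGamma_letters (f := f)) => q' z; rewrite /act_pair /=.
rewrite -{1}(cat_take_drop k.+1 (w z)) foldl_cat.
have : size (drop k.+1 (w z)) <= 1 by rewrite size_drop leq_subLR addn1.
by case: (drop _ _) => [|a []].
Qed.

Definition pow_act I Q Z (d : Q -> Z -> Q) (t : {ffun I -> Q}) z :
    {ffun I -> Q} :=
  [ffun i => d (t i) z].

Lemma vGamma_pow I Q Z (d : Q -> Z -> Q) (t : {ffun I -> Q}) :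
  (forall q, vGamma d q) -> vGamma (pow_act d) t.
Proof.
move=> Gd.
pose act_on (s : seq I) (t : {ffun I -> Q}) z : {ffun I -> Q} :=
  [ffun i => if i \in s then d (t i) z else t i].
suff: vGamma (act_on (enum I)) t.
  by apply: eq_vGamma => t' z; apply/ffunP => i; rewrite !ffunE mem_enum.
elim: (enum I) t => [|i s IHs] t.
  apply: eq_vGamma (vGamma_trivial t) => t' z.
  by apply/ffunP => i; rewrite ffunE.
pose set_i (tq : {ffun I -> Q} * Q) : {ffun I -> Q} :=
  [ffun j => if j == i then tq.2 else tq.1 j].
have -> : t = set_i (t, t i).
  by apply/ffunP => j; rewrite ffunE; case: eqP => // ->.
have := vGamma_cascade (fun=> id) (q := (t, t i)) (IHs t) (Gd _).
apply: vGamma_quotient => -[t' q] z; apply/ffunP => j; rewrite !ffunE /= inE.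
by case: eqP.
Qed.

(* The inner dagger solves for the variables reached by letters in [B]. A letter
   [(n, c)] of the outer system stands for the words [u c] with [u] in [B^*]
   leading from [n0] to [n]. *)
Section SplitAlphabet.
Variables (B D N : finType) (dN : N -> B -> N) (n0 : N).
Variables (A C : K) (P : finType) (G : family P (B + D)%type A C).

Definition inner_system (np : N * P) :
    Hom (prod (fpow (N * P)%type A) (prod (fpow ((N * D) * P)%type A) C)) A :=
  layer (fun zp => match zp.1 with
                   | inl b => inl (dN np.1 b, zp.2)
                   | inr c => inr ((np.1, c), zp.2)
                   end) (G np.2).

Definition outer_family (p : P) : Hom (prod (fpow ((N * D) * P)%type A) C) A :=
  sol dag inner_system (n0, p).

Hypothesis Gn0 : vGamma dN n0.

Lemma sol_sys_split Q (d : Q -> B + D -> Q) (a : Q -> N -> Q) q p :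
  (forall q, a q n0 = q) -> (forall q n b, a q (dN n b) = d (a q n) (inl b)) ->
  sol dag (sys d G) (q, p)
  = sol dag (sys (fun q nc => d (a q nc.1) (inr nc.2)) outer_family) (q, p).
Proof.
move=> a_n0 a_act.
pose s (qp : Q * P) (zp : (B + D) * P) : Q * P + Q * P :=
  match zp.1 with
  | inl b => inl (d qp.1 (inl b), zp.2)
  | inr c => inr (d qp.1 (inr c), zp.2)
  end.
transitivity (sol dag (sol dag (fun qp => layer (s qp) (G qp.2))) (q, p)).
  rewrite sol_layer //; apply: eq_sol => qp.
  by apply: eq_reindex => -[[b|c] p'].
apply: eq_sol => {q p} -[q p]; rewrite /sys -sol_layer_outer //.
pose G' (qp : Q * P) := layer (fun zp : (B + D) * P =>
  match zp.1 with
  | inl b => inl (b, (d qp.1 (inl b), zp.2))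
  | inr c => inr (d qp.1 (inr c), zp.2)
  end) (G qp.2).
transitivity (sol dag (sys dN G') (n0, (q, p))).
  rewrite Gn0; symmetry.
  apply: (sol_subsystem HK (s := fun qp => (tt, qp)) (q, p)) => [? ? []//|qp].
  by rewrite /sys !reindex_layer; apply: eq_subst => -[[b|c] p'].
rewrite -{1}(a_n0 q).
apply: (sol_subsystem HK (s := fun np => (np.1, (a q np.1, np.2))) (n0, p)).
  by move=> [? ?] [? ?] [-> _ ->].
move=> [n p']; rewrite /sys !reindex_layer.
by apply: eq_subst => -[[b|c] p''] //=; rewrite a_act.
Qed.

End SplitAlphabet.

Lemma vGamma_split Q B D N (d : Q -> B + D -> Q) (dN : N -> B -> N) n0
    (a : Q -> N -> Q) q :
  (forall q, a q n0 = q) -> (forall q n b, a q (dN n b) = d (a q n) (inl b)) ->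
  vGamma dN n0 -> vGamma (fun q nc => d (a q nc.1) (inr nc.2)) q -> vGamma d q.
Proof.
move=> a_n0 a_act Gn0 Gq A C P G p.
rewrite (sol_sys_split G Gn0 _ _ a_n0 a_act) Gq.
by rewrite (sol_sys_split (a := fun _ _ => tt) G Gn0) // => -[].
Qed.

End Systems.

Section Division.
Local Open Scope group_scope.
Implicit Types S M T : semigroupType.

Definition partial_morphism S T (f : S -> option T) : Prop :=
  forall x y s t, f x = Some s -> f y = Some t -> f (x * y) = Some (s * t).

Definition partial_onto S T (f : S -> option T) : Prop :=
  forall t, exists x, f x = Some t.

Definition divides S M : Prop :=
  exists2 f : M -> option S, partial_morphism f & partial_onto f.

Lemma divides_refl S : divides S S.
Proof. by exists Some => [x y s t [->] [->]|s] //; exists s. Qed.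

Lemma divides_trans S T M : divides S T -> divides T M -> divides S M.
Proof.
move=> [f fM f_onto] [g gM g_onto]; exists (fun x => obind f (g x)).
  move=> x y s t; case gx: (g x) => [a|] // fa; case gy: (g y) => [b|] // fb.
  by rewrite (gM _ _ _ _ gx gy); apply: fM.
move=> s; have [t ft] := f_onto s; have [x gx] := g_onto t.
by exists x; rewrite gx.
Qed.

Lemma divides_subg (P : finGroupType) (N : {group P}) : divides (subg_of N) P.
Proof.
exists (insub : P -> option (subg_of N)) => [x y s t|s]; last first.
  by exists (val s); apply: valK.
case: insubP => // s' _ <- [->]; case: insubP => // t' _ <- [->].
by rewrite -[val s * val t]/(val (s * t)) valK.
Qed.

Lemma divides_coset (P : finGroupType) (N : {group P}) :
  N <| [set: P] -> divides (coset_of N) P.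
Proof.
case/andP=> _ nN.
exists (fun x => Some (coset N x)) => [x y s t [<-] [<-]|s].
  by rewrite morphM // (subsetP nN) ?inE.
by exists (repr s); rewrite coset_reprK.
Qed.

(* The sandwich condition is symmetric in left and right, so it yields both
   one-sided units and both one-sided inverses at once. *)
Lemma sandwich_group M (H : {pred M}) x0 :
  x0 \in H -> mulg_closed H ->
  {in H & &, forall x y z, exists2 t, t \in H & z = x * t * y} ->
  exists2 e, e \in H &
    {in H, forall x, [/\ e * x = x, x * e = x &
                         exists2 y, y \in H & x * y = e /\ y * x = e]}.
Proof.
move=> Hx0 HM sandwich.
have [t Ht x0E] := sandwich _ _ _ Hx0 Hx0 Hx0.
pose e := x0 * t; have He : e \in H by apply: HM.
have e_mul x : x \in H -> e * x = x.
  by move=> /(sandwich _ _ _ Hx0 Hx0)[y _ ->]; rewrite !mulgA -x0E.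
have mul_e x : x \in H -> x * e = x.
  suff -> : e = t * x0.
    move=> /(sandwich _ _ _ Hx0 Hx0)[y _ ->].
    by rewrite -!mulgA (mulgA x0 t) -x0E.
  rewrite -[RHS]e_mul ?HM //; have [y _ eE] := sandwich _ _ _ Hx0 Hx0 He.
  by rewrite {1 2}eE -!mulgA (mulgA x0 t) -x0E.
exists e => // x Hx; split; [exact: e_mul | exact: mul_e |].
have [y Hy eE] := sandwich _ _ _ Hx Hx He.
have xyC : x * y = y * x.
  by rewrite -[LHS]mul_e ?HM // -[RHS]e_mul ?HM // eE !mulgA.
by exists (y * x); [exact: HM | rewrite -{2}xyC mulgA -eE].
Qed.

End Division.

(* An alias, because [{ffun Q -> Q}] carries the pointwise product. *)
Definition transf (Q : finType) : predArgType := {ffun Q -> Q}.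

HB.instance Definition _ (Q : finType) := Finite.copy (transf Q) {ffun Q -> Q}.

Section Transformations.
Variable Q : finType.
Local Open Scope group_scope.

Definition transf_one : transf Q := [ffun q => q].
Definition transf_mul (f g : transf Q) : transf Q := [ffun q => g (f q)].

Lemma transf_mulA : associative transf_mul.
Proof. by move=> f g h; apply/ffunP => q; rewrite !ffunE. Qed.

Lemma transf_mul1f : left_id transf_one transf_mul.
Proof. by move=> f; apply/ffunP => q; rewrite !ffunE. Qed.

Lemma transf_mulf1 : right_id transf_one transf_mul.
Proof. by move=> f; apply/ffunP => q; rewrite !ffunE. Qed.

HB.instance Definition _ :=
  isMonoid.Build (transf Q) transf_mulA transf_mul1f transf_mulf1.

Lemma transfM (f g : transf Q) q : (f * g) q = g (f q).
Proof. exact: ffunE. Qed.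

Lemma transf1 q : (1 : transf Q) q = q.
Proof. exact: ffunE. Qed.

Section GroupPreimage.
Variables (G : finGroupType) (f : transf Q -> option G).
Hypothesis fM : partial_morphism f.
Hypothesis f_onto : partial_onto f.

Definition onto_subsemigroup (H : {set transf Q}) : bool :=
  [&& [forall x in H, forall y in H, x * y \in H], [forall x in H, f x] &
      [forall g, Some g \in f @: H]].

Lemma onto_subsemigroupP (H : {set transf Q}) :
  reflect [/\ mulg_closed H, {in H, forall x, f x} &
              forall g, Some g \in f @: H]
          (onto_subsemigroup H).
Proof.
apply: (iffP and3P) => -[HM Hf Honto]; split.
- by move=> x y Hx; apply/forall_inP: y; apply: (forall_inP HM).
- exact/forall_inP.
- exact/forallP.
- by apply/forall_inP => x Hx; apply/forall_inP => y; apply: HM.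
- exact/forall_inP.
- exact/forallP.
Qed.

Lemma onto_subsemigroup_sandwich (H : {set transf Q}) x y :
  onto_subsemigroup H -> x \in H -> y \in H ->
  onto_subsemigroup [set x * z * y | z in H].
Proof.
move=> /onto_subsemigroupP[HM Hf Honto] Hx Hy; apply/onto_subsemigroupP; split.
- move=> _ _ /imsetP[z Hz ->] /imsetP[z' Hz' ->]; apply/imsetP.
  by exists (z * (y * x) * z'); rewrite ?mulgA // !HM.
- by move=> _ /imsetP[z Hz ->]; rewrite Hf // !HM.
- move=> g; case fx: (f x) (Hf x Hx) => [a|] // _.
  case fy: (f y) (Hf y Hy) => [b|] // _.
  have /imsetP[z Hz fz] := Honto (a^-1 * g * b^-1).
  apply/imsetP; exists (x * z * y); first exact: imset_f.
  by rewrite (fM (fM fx (esym fz)) fy) mulgA mulKVg mulgKV.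
Qed.

(* A minimal subsemigroup mapping onto [G] equals each of its sandwiches. *)
Lemma exists_sandwich_subsemigroup :
  exists2 H : {set transf Q}, onto_subsemigroup H &
    {in H & &, forall x y z, exists2 t, t \in H & z = x * t * y}.
Proof.
have dom_onto : onto_subsemigroup [set x | f x].
  apply/onto_subsemigroupP; split=> [x y|x|g]; rewrite ?inE //.
    case fx: (f x) => [a|] // _; case fy: (f y) => [b|] // _.
    by rewrite (fM fx fy).
  by have [x fx] := f_onto g; apply/imsetP; exists x; rewrite ?inE fx.
have [H /minsetP[H_onto H_min] _] := minset_exists dom_onto.
exists H => // x y z Hx Hy; have [HM _ _] := onto_subsemigroupP _ H_onto.
rewrite -{1}(H_min _ (onto_subsemigroup_sandwich H_onto Hx Hy)).
  by case/imsetP=> t Ht ->; exists t.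
by apply/subsetP => _ /imsetP[t Ht ->]; rewrite !HM.
Qed.

End GroupPreimage.

End Transformations.

Section TransitionMonoid.
Variables (Q Z : finType) (d : Q -> Z -> Q).
Local Open Scope group_scope.

Definition letter z : transf Q := [ffun q => d q z].

Definition word u : transf Q := \prod_(z <- u) letter z.

Lemma wordE u q : word u q = foldl d q u.
Proof.
rewrite /word; elim: u q => [|z u IHu] q; first by rewrite big_nil transf1.
by rewrite big_cons transfM IHu ffunE.
Qed.

Lemma word_cat u v : word (u ++ v) = word u * word v.
Proof. exact: big_cat. Qed.

Definition mul_letter : rel (transf Q) :=
  [rel f g | [exists z, g == f * letter z]].

Definition transition : pred (transf Q) := connect mul_letter 1.

Lemma transitionP f : reflect (exists u, f = word u) (transition f).
Proof.
have path_word g s : path mul_letter g s -> exists u, last g s = g * word u.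
  elim: s g => [|h s IHs] g /=.
    by exists [::]; rewrite /word big_nil mulg1.
  case/andP=> /existsP[z /eqP->] /IHs[u ->].
  by exists (z :: u); rewrite /word big_cons mulgA.
apply: (iffP idP) => [/connectP[s /path_word[u lastE] ->]|[u ->]].
  by exists u; rewrite lastE mul1g.
elim/last_ind: u => [|u z IHu]; first by rewrite /word big_nil; apply: connect0.
apply: connect_trans IHu (connect1 _); apply/existsP; exists z.
by rewrite -cats1 word_cat [word [:: z]]big_seq1.
Qed.

Lemma transition_closed : monoid_closed transition.
Proof.
split; first exact: connect0.
move=> f g /transitionP[u ->] /transitionP[v ->]; apply/transitionP.
by exists (u ++ v); rewrite word_cat.
Qed.

Definition transition_monoid : predArgType := {f | transition f}.

HB.instance Definition _ := SubFinite.copy transition_monoid {f | transition f}.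
HB.instance Definition _ :=
  SubChoice_isSubMonoid.Build _ _ transition_monoid transition_closed.

Lemma transition_word u : transition (word u).
Proof. by apply/transitionP; exists u. Qed.

Definition tword u : transition_monoid := Sub (word u) (transition_word u).

Lemma tword_onto (m : transition_monoid) : exists u, m = tword u.
Proof. by have /transitionP[u mE] := valP m; exists u; apply: val_inj. Qed.

Lemma val_tword u q : val (tword u) q = foldl d q u.
Proof. exact: wordE. Qed.

Lemma tword_cat u v : tword (u ++ v) = tword u * tword v.
Proof. by apply: val_inj; rewrite valM /= word_cat. Qed.

Lemma val_mul_tword (m : transition_monoid) u q :
  val (m * tword u) q = foldl d (val m q) u.
Proof. by rewrite valM transfM val_tword. Qed.

Lemma tword_nil : tword [::] = 1.
Proof. by apply: val_inj; rewrite /= /word big_nil. Qed.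

End TransitionMonoid.

Section TransitionMonoidDivision.
Local Open Scope group_scope.

Lemma transition_monoid_divides (Q Q' Z Z' : finType) (d : Q -> Z -> Q)
    (d' : Q' -> Z' -> Q') (i : Q' -> Q) :
  injective i ->
  (forall z, exists m : transition_monoid d,
     forall q, val m (i q) = i (d' q z)) ->
  divides (transition_monoid d') (transition_monoid d).
Proof.
move=> i_inj lift_letter.
pose lifts (m : transition_monoid d) (m' : transition_monoid d') :=
  [forall q, val m (i q) == i (val m' q)].
have liftsP (m : transition_monoid d) (m' : transition_monoid d') :
    reflect (forall q, val m (i q) = i (val m' q)) (lifts m m').
  exact: 'forall_eqP.
pose f m := [pick m' | lifts m m'].
have fE m m' : f m = Some m' <-> lifts m m'.
  rewrite /f; case: pickP => [m1 /liftsP mm1|no_lift]; last first.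
    by split=> //; rewrite no_lift.
  split=> [[<-]|/liftsP mm']; first exact/liftsP.
  by congr Some; apply/val_inj/ffunP => q; apply: i_inj; rewrite -mm1 mm'.
exists f => [x y s t /fE/liftsP xs /fE/liftsP yt|m'].
  by apply/fE/liftsP => q; rewrite !valM !transfM xs yt.
suff [m mm'] : exists m, lifts m m' by exists m; apply/fE.
have [u ->] := tword_onto m'; elim: u => [|z u [m /liftsP mu]].
  by exists 1; apply/liftsP => q; rewrite tword_nil !val1 !transf1.
have [mz mzE] := lift_letter z.
by exists (mz * m); apply/liftsP => q; rewrite valM transfM mzE mu !val_tword.
Qed.

Lemma divides_monoidP (G : finGroupType) (Q : automaton) :
  divides_monoid G Q <-> divides G (transition_monoid (@act Q)).
Proof.
split=> [[H [e [HQ [HM _] _ _ [phi [phiM phi_onto]]]]]|[f fM f_onto]].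
  pose f (m : transition_monoid (@act Q)) :=
    if val m \in H then Some (phi (val m)) else None.
  exists f => [x y s t|g].
    rewrite /f valM; case: ifP => // Hx [<-]; case: ifP => // Hy [<-].
    by rewrite (HM _ _ Hx Hy) -phiM.
  have [x Hx <-] := phi_onto g; have [u xE] := HQ x Hx.
  have valE : val (tword (@act Q) u) = x.
    by apply/ffunP => q; rewrite val_tword xE.
  by exists (tword (@act Q) u); rewrite /f valE Hx.
pose f' (x : transf (st Q)) := obind f (insub x).
have f'M : partial_morphism f'.
  move=> x y s t; rewrite /f'.
  case: insubP => // m _ <- fm; case: insubP => // m' _ <- fm'.
  by rewrite -valM valK; apply: fM.
have f'_onto : partial_onto f'.
  by move=> g; have [m fm] := f_onto g; exists (val m); rewrite /f' valK.
have [H /onto_subsemigroupP[HM Hf Honto] sandwich] :=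
  exists_sandwich_subsemigroup f'M f'_onto.
have [x1 Hx1] : exists x, x \in H by have /imsetP[x Hx _] := Honto 1; exists x.
have [e He group_H] := sandwich_group Hx1 HM sandwich.
exists H, e; split=> //.
- move=> x /Hf; rewrite /f'; case: insubP => // m _ <- _.
  by have [u ->] := tword_onto m; exists u => q; rewrite val_tword.
- by move=> x /group_H[].
- by move=> x /group_H[].
- exists (fun x => odflt 1 (f' x)); split=> [x y /Hf + /Hf|g].
    case fx: (f' x) => [a|] // _; case fy: (f' y) => [b|] // _.
    have fxy : f' (Mmul x y) = Some (a * b) := f'M _ _ _ _ fx fy.
    by rewrite fxy.
  by have /imsetP[x Hx fx] := Honto g; exists x; rewrite -?fx.
Qed.

Lemma partial_morphism_nonempty_word (G : finGroupType) (Q Z : finType)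
    (d : Q -> Z -> Q) (f : transition_monoid d -> option G) g :
  [set: G] != 1 -> partial_morphism f -> partial_onto f ->
  exists2 u, 0 < size u & f (tword d u) = Some g.
Proof.
move=> /trivgPn[g0 _ g0_neq1] fM f_onto.
have word_neq1 h : h != 1 -> exists2 u, 0 < size u & f (tword d u) = Some h.
  move=> h_neq1; have [m] := f_onto h; have [u ->] := tword_onto m => fu.
  exists u => //; case: u fu => //; rewrite tword_nil => f1.
  have := fM _ _ _ _ f1 f1; rewrite mulg1 f1 => -[hh].
  by case/eqP: h_neq1; apply: (mulgI h); rewrite mulg1 -hh.
have [->{g}|] := eqVneq g 1; last exact: word_neq1.
have [u u_gt0 fu] := word_neq1 _ g0_neq1.
have [|v _ fv] := word_neq1 g0^-1; first by rewrite invg_eq1.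
exists (u ++ v); first by rewrite size_cat addn_gt0 u_gt0.
by rewrite tword_cat (fM _ _ _ _ fu fv) mulgV.
Qed.

End TransitionMonoidDivision.

Section Groups.
Variables (K : cartCat) (dag : daggerOp K) (HK : conway dag).
Local Open Scope group_scope.

Definition vGamma_group (G : finGroupType) : Prop :=
  forall q : G, vGamma dag (fun x y : G => x * y) q.

Definition vGamma_simple_divisors (M : semigroupType) : Prop :=
  forall G : finGroupType,
    simple [set: G] -> divides G M -> vGamma_group G.

Lemma vGamma_simple_divisors_trans (S M : semigroupType) :
  divides S M -> vGamma_simple_divisors M -> vGamma_simple_divisors S.
Proof. by move=> divS GM G sG /divides_trans/(_ divS)/GM; apply. Qed.

Lemma Gamma_group_vGamma (G : finGroupType) :
  Gamma_group dag G <-> vGamma_group G.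
Proof.
apply: (iff_trans (Gamma_forall_init _ _)).
by split=> GG q; apply/(Gamma_init_vGamma HK (Q := group_automaton G))/GG.
Qed.

Lemma vGamma_group_divides (G : finGroupType) (Q Z : finType)
    (d : Q -> Z -> Q) :
  [set: G] != 1 -> divides G (transition_monoid d) ->
  (forall q, vGamma dag d q) -> vGamma_group G.
Proof.
move=> G_neq1 [f fM f_onto] Gd.
have /fin_all_exists2[w w_gt0 fw] g :=
  partial_morphism_nonempty_word g G_neq1 fM f_onto.
pose T := {m | f m}.
have T_act (m : T) g : f (val m * tword d (w g)).
  by case fm: (f (val m)) (valP m) => [h|] // _; rewrite (fM _ _ _ _ fm (fw g)).
pose dT (m : T) g : T :=
  exist (fun m => f m) (val m * tword d (w g)) (T_act m g).
pose value (m : T) : G := odflt 1 (f (val m)).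
move=> g; have [m fm] := f_onto g.
have Tm : f m by rewrite fm.
have -> : g = value (exist _ m Tm) by rewrite /value /= fm.
apply: (vGamma_quotient HK (d := dT)).
  move=> m' h; rewrite /value /=.
  case fm': (f (val m')) (valP m') => [h'|] // _.
  by rewrite (fM _ _ _ _ fm' (fw h)).
apply/(vGamma_subautomaton HK (d := pow_act (fun q g => foldl d q (w g)))
  (i := val \o val)).
- exact: inj_comp val_inj val_inj.
- by move=> m' h; apply/ffunP => q; rewrite [RHS]ffunE; apply: val_mul_tword.
by apply: vGamma_pow => // q; apply: vGamma_words.
Qed.

Lemma vGamma_group_extension (P : finGroupType) (N : {group P}) :
  N <| [set: P] -> vGamma_group (subg_of N) -> vGamma_group (coset_of N) ->
  vGamma_group P.
Proof.
move=> /andP[_ nN] GN GPN p.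
have inN x : x \in 'N(N) by rewrite (subsetP nN) ?inE.
have coset_repr_in x y : coset N x = y -> x * (repr y)^-1 \in N.
  move=> <-; apply: coset_idr => //.
  by rewrite morphM ?morphV ?inN //= coset_reprK mulgV.
pose cocycle (x : coset_of N) (y : P) : subg_of N :=
  subg N (repr x * y * (repr (x * coset N y))^-1).
have cocycleE x y : val (cocycle x y) = repr x * y * (repr (x * coset N y))^-1.
  by apply/subgK/coset_repr_in; rewrite morphM ?inN //= coset_reprK.
pose h (xn : coset_of N * subg_of N) : P := val xn.2 * repr xn.1.
have -> : p = h (coset N p, subg N (p * (repr (coset N p))^-1)).
  by rewrite /h /= subgK ?mulgKV // coset_repr_in.
apply: (vGamma_quotient HK (d :=
    cascade (fun x y => x * coset N y) (fun x y => x * y) cocycle)).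
  move=> [x n] y; rewrite /h /= [sgval (cocycle _ _)]cocycleE.
  by rewrite !mulgA mulgKV.
apply: (vGamma_cascade HK) => //=; exact: vGamma_letters (GPN _).
Qed.

Lemma vGamma_group_of_simple (P : finGroupType) :
  vGamma_simple_divisors P -> vGamma_group P.
Proof.
have [k] := ubnP #|P|; elim: k P => // k IHk P; rewrite ltnS => lePk simpleG.
have [P1|P_neq1] := eqVneq [set: P] 1.
  move=> p; apply: eq_vGamma (vGamma_trivial HK p) => x y.
  have eq1 (z : P) : z = 1 by apply/set1gP; rewrite -P1 inE.
  by rewrite [LHS]eq1 [RHS]eq1.
have [/existsP[N /and3P[nN N1 NT]]|/existsPn no_normal] := boolP
  [exists N : {group P}, [&& N <| [set: P], N :!=: 1 & N :!=: [set: P]]].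
  apply: (vGamma_group_extension nN); apply: IHk.
  - apply: leq_trans lePk.
    by rewrite card_sub -cardsT proper_card // properEneq NT subsetT.
  - exact: vGamma_simple_divisors_trans (divides_subg N) simpleG.
  - apply: leq_trans lePk; rewrite -cardsT -quotientT -[#|P|]cardsT.
    exact: ltn_quotient N1 (subsetT N).
  - exact: vGamma_simple_divisors_trans (divides_coset nN) simpleG.
apply: simpleG (divides_refl P); apply/simpleP; split=> // N nN.
have := no_normal N; rewrite nN /= negb_and !negbK.
by case/orP => /eqP; [left | right].
Qed.

End Groups.

Section PermutationAutomata.
Variables (Q Z : finType) (d : Q -> Z -> Q).
Hypothesis d_inj : forall z, injective (d^~ z).
Local Open Scope group_scope.

Definition letter_perm z : {perm Q} := perm (@d_inj z).

Definition transition_group : {group {perm Q}} :=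
  <<[set letter_perm z | z : Z]>>%G.

Lemma letter_perm_in z : letter_perm z \in transition_group.
Proof. by rewrite mem_gen // imset_f. Qed.

Lemma transition_group_word x :
  x \in transition_group -> exists u, forall q, x q = foldl d q u.
Proof.
case/gen_prodgP=> n [c c_letter ->].
elim: n c c_letter => [|n IHn] c c_letter.
  by exists [::] => q; rewrite big_ord0 perm1.
have [u uE] := IHn _ (fun i => c_letter (widen_ord (leqnSn n) i)).
have /imsetP[z _ cz] := c_letter ord_max.
by exists (rcons u z) => q; rewrite big_ord_recr foldl_rcons permM uE cz permE.
Qed.

Lemma divides_transition_group :
  divides (subg_of transition_group) (transition_monoid d).
Proof.
pose f (m : transition_monoid d) : option (subg_of transition_group) :=
  obind (fun s : {perm Q} => insub s) (insub (val m : {ffun Q -> Q})).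
have fE m x : f m = Some x <-> forall q, val m q = val x q.
  rewrite /f; split=> [|mx].
    case: insubP => //= s _ <-; case: insubP => // y _ <- [<-] q.
    by rewrite pvalE.
  have -> : val m = val (val x) :> {ffun Q -> Q}.
    by apply/ffunP => q; rewrite mx -pvalE.
  by rewrite valK /= valK.
exists f => [m n x y /fE mx /fE ny|x].
  by apply/fE => q; rewrite valM transfM mx ny -permM.
have [u uE] := transition_group_word (valP x).
by exists (tword d u); apply/fE => q; rewrite val_tword uE.
Qed.

End PermutationAutomata.

Section LetterReduction.
Variables (Q Z : finType) (d : Q -> Z -> Q) (c : Z).
Local Open Scope group_scope.

Definition other_letter : finType := {z | z != c}.

Definition act_other (q : Q) (b : other_letter) : Q := d q (val b).

Definition letter_image : finType := {q | q \in codom (d^~ c)}.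

Definition act_letter (q : Q) : letter_image :=
  Sub (d q c) (codom_f (d^~ c) q).

Definition act_image (r : letter_image) (m : transition_monoid act_other) :
    letter_image :=
  act_letter (val m (val r)).

Lemma card_other_letter : #|other_letter| < #|Z|.
Proof.
rewrite card_sub; apply: proper_card; apply/properP.
by split; [apply/subsetP | exists c; rewrite ?inE ?eqxx].
Qed.

Lemma card_letter_image : ~ injective (d^~ c) -> #|letter_image| < #|Q|.
Proof.
move=> c_noninj; rewrite card_sub ltn_neqAle leq_image_card andbT.
apply/eqP => /eqP/image_injP inj_c; apply: c_noninj => x y.
exact: inj_c.
Qed.

Lemma divides_act_other :
  divides (transition_monoid act_other) (transition_monoid d).
Proof.
apply: (transition_monoid_divides (i := id)) => // b.
by exists (tword d [:: val b]) => q; rewrite val_tword.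
Qed.

Lemma divides_act_image :
  divides (transition_monoid act_image) (transition_monoid d).
Proof.
apply: (transition_monoid_divides val_inj) => m.
have [u ->] := tword_onto m.
exists (tword d (rcons (map val u) c)) => r.
rewrite val_tword foldl_rcons SubK val_tword; congr (d _ c).
by elim: u (val r) => //= b u IHu q; rewrite IHu.
Qed.

Variables (K : cartCat) (dag : daggerOp K) (HK : conway dag).

Lemma vGamma_letter_reduction :
  (forall q, vGamma dag act_other q) -> (forall r, vGamma dag act_image r) ->
  forall q, vGamma dag d q.
Proof.
move=> Gother Gimage q.
pose d' (q : Q) (z : other_letter + unit) :=
  if z is inl b then act_other q b else d q c.
pose f (z : Z) : other_letter + unit := oapp inl (inr tt) (insub z).
apply: (vGamma_letters (d := d') (f := f)) => [{}q z|].
  by rewrite /f; case: insubP => [b _ <- //|]; rewrite negbK => /eqP->.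
pose mul_act (m : transition_monoid act_other) b := m * tword act_other [:: b].
apply: (vGamma_split HK (d := d') (dN := mul_act) (n0 := 1)
    (a := fun q m => val m q)) => [{}q|{}q m b||].
- by rewrite val1 transf1.
- by rewrite val_mul_tword.
- apply/(vGamma_subautomaton HK (d := pow_act act_other) (i := val)).
  + exact: val_inj.
  + by move=> m b; apply/ffunP => {}q; rewrite [RHS]ffunE; apply: val_mul_tword.
  + exact: vGamma_pow.
apply: (vGamma_unfold HK) => -[m u] /=.
apply/(vGamma_subautomaton HK (d' := fun r mu => act_image r mu.1)
  (i := val) (act_letter (val m q))) => //.
  exact: val_inj.
exact: vGamma_letters (Gimage _).
Qed.

End LetterReduction.

Section Decomposition.
Variables (K : cartCat) (dag : daggerOp K) (HK : conway dag).

Lemma vGamma_permutations (Q Z : finType) (d : Q -> Z -> Q) :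
  (forall z, injective (d^~ z)) ->
  vGamma_simple_divisors dag (transition_monoid d) ->
  forall q, vGamma dag d q.
Proof.
move=> d_inj simpleG q.
pose W := transition_group d_inj.
have GW : vGamma_group dag (subg_of W).
  apply: (vGamma_group_of_simple HK).
  exact: vGamma_simple_divisors_trans (divides_transition_group _) simpleG.
have -> : q = val (1%g : subg_of W) q by rewrite [val _]morph1 perm1.
apply: (vGamma_quotient HK
  (d := fun x z => (x * subg W (letter_perm d_inj z))%g)
  (h := fun x : subg_of W => val x q)).
  by move=> x z; rewrite /= subgK ?letter_perm_in // permM permE.
exact: vGamma_letters (GW _).
Qed.

Lemma vGamma_of_simple (Q Z : finType) (d : Q -> Z -> Q) :
  vGamma_simple_divisors dag (transition_monoid d) ->
  forall q, vGamma dag d q.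
Proof.
have [n] := ubnP #|Q|; have [m] := ubnP #|Z|.
elim: n m Q Z d => // n IHn; elim=> // m IHm Q Z d.
rewrite !ltnS => leZm leQn simpleG.
have [/forallP d_inj|/forallPn[c /injectiveP c_noninj]] :=
    boolP [forall z, injectiveb (d^~ z)].
  by apply: vGamma_permutations => // z; apply/injectiveP.
apply: (vGamma_letter_reduction (c := c) HK).
  apply: IHm.
  - exact: leq_trans (card_other_letter c) leZm.
  - by rewrite ltnS.
  - exact: vGamma_simple_divisors_trans (divides_act_other d c) simpleG.
apply: IHn (ltnSn _) _ _.
  exact: leq_trans (card_letter_image c_noninj) leQn.
exact: vGamma_simple_divisors_trans (divides_act_image d c) simpleG.
Qed.

End Decomposition.

Theorem theorem5p2
  (Qs : init_automaton -> Prop)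
  (HQs : forall Qq, Qs Qq -> initially_connected Qq)
  (K : cartCat) (dag : daggerOp K) (HK : conway dag) :
  (forall Qq, Qs Qq -> Gamma_init dag (projT2 Qq)) <->
  (forall G : finGroupType,
      simple [set: G] ->
      (exists Qq, Qs Qq /\ divides_monoid G (projT1 Qq)) ->
      Gamma_group dag G).
Proof.
split=> [GQs G /simpleP[G_neq1 _] [[Q q0] [QsQ]]|GGs [Q q] QsQ].
  move=> /divides_monoidP divG.
  apply/(Gamma_group_vGamma HK)/(vGamma_group_divides HK G_neq1 divG) => q.
  have [u ->] := HQs _ QsQ q; apply: (vGamma_foldl HK).
  exact/(Gamma_init_vGamma HK)/(GQs _ QsQ).
apply/(Gamma_init_vGamma HK)/(vGamma_of_simple HK) => G sG.
move=> /divides_monoidP divG.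
by apply/(Gamma_group_vGamma HK)/GGs => //; exists (existT _ Q q).
Qed.
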